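(* For every sufficiently large $N\in\mathbb{N}$ there exists a connected graph $G$ with $N$ vertices such that, writing the eigenvalues of its Laplacian matrix $L(G)$ (with multiplicity) as $0=\lambda_1<\lambda_2\le\cdots\le\lambda_N$, for every $i$ with $1<i<N$ there is at least one eigenvector $f_{\lambda_i}$ of $L(G)$ corresponding to $\lambda_i$ with $\mathcal{D}(f_{\lambda_i})=2$.
   Context: All graphs are finite, simple and undirected. The Laplacian matrix of a graph is $L=D-A$, where $A$ is the adjacency matrix and $D$ the diagonal matrix of vertex degrees. Strong nodal domains: for a vector $g$ on $V(G)$ with no zero entry, a strong nodal domain of $g$ is a maximal connected subgraph $H$ of $G$ such that $g(i)g(j)>0$ for all $i,j\in V(H)$; equivalently, a connected component of the subgraph induced on $\{g>0\}$ or on $\{g<0\}$. Number of nodal decomposition $\mathcal{D}(f)$: for an eigenvector $f$ of $L(G)$, $\mathcal{D}(f)$ is the minimum, over all vectors $g$ with $g(v)=f(v)$ whenever $f(v)\ne 0$ and $g(v)\in\{-1,1\}$ whenever $f(v)=0$, of the number of strong nodal domains of $g$. *)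

(* Defs.v *)
From HB Require Import structures.
From mathcomp Require Import all_boot all_order all_algebra.
From mathcomp Require Import boolp reals.

Set Implicit Arguments.
Unset Strict Implicit.
Unset Printing Implicit Defensive.

Import Order.TTheory GRing.Theory Num.Theory.
Local Open Scope ring_scope.

Record sgraph (n : nat) := SGraph {
  adj : rel 'I_n;
  adj_sym : symmetric adj;
  adj_irr : irreflexive adj }.

Section Graph.
Variables (n : nat) (G : sgraph n).

(* The subgraph of G induced on S is connected; the empty graph is not. *)
Definition connected_set (S : {set 'I_n}) : bool :=
  (S != set0) &&
  [forall x in S, forall y in S, connect [rel u v in S | adj G u v] x y].

Definition connected_graph : bool := connected_set setT.

Definition degree (v : 'I_n) : nat := #|[set w | adj G v w]|.

Variable R : realType.

Definition adjacency_matrix : 'M[R]_n := \matrix_(i, j) (adj G i j)%:R.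

Definition degree_matrix : 'M[R]_n := diag_mx (\row_i (degree i)%:R).

Definition laplacian : 'M[R]_n := degree_matrix - adjacency_matrix.

(* Strong nodal domains are represented by their vertex sets: a maximal
   connected subgraph with a condition on its vertices only is induced. *)
Definition one_signed_connected (g : 'cV[R]_n) (S : {set 'I_n}) : bool :=
  connected_set S && [forall i in S, forall j in S, 0 < g i 0 * g j 0].

Definition strong_nodal_domains (g : 'cV[R]_n) : {set {set 'I_n}} :=
  [set S | maxset (one_signed_connected g) S].

Definition sign_filling (f g : 'cV[R]_n) : Prop :=
  forall v, (f v 0 != 0 -> g v 0 = f v 0) /\
            (f v 0 = 0 -> g v 0 = -1 \/ g v 0 = 1).

Definition filling_count (f : 'cV[R]_n) (k : nat) : Prop :=
  exists2 g, sign_filling f g & #|strong_nodal_domains g| = k.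

Lemma filling_count_ex (f : 'cV[R]_n) : exists k, `[< filling_count f k >].
Proof.
pose g : 'cV[R]_n := \col_v (if f v 0 == 0 then 1 else f v 0).
exists #|strong_nodal_domains g|; apply/asboolP; exists g => // v.
by rewrite mxE; case: eqP => fv0; split=> //; right.
Qed.

Definition nodal_decomposition_number (f : 'cV[R]_n) : nat :=
  ex_minn (filling_count_ex f).

End Graph.

Definition eigenvector (R : realType) (n : nat) (A : 'M[R]_n) (a : R)
    (f : 'cV[R]_n) : Prop :=
  f != 0 /\ A *m f = a *: f.

(* The eigenvalues of A with algebraic multiplicity, in nondecreasing order. *)
Definition ordered_eigenvalues (R : realType) (n : nat) (A : 'M[R]_n)
    (lam : n.-tuple R) : Prop :=
  sorted <=%R lam /\ char_poly A = \prod_(x <- lam) ('X - x%:P).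

(* Main.v *)
Require Import Defs.
From HB Require Import structures.
From mathcomp Require Import all_boot all_order all_algebra.
From mathcomp Require Import boolp reals.

(** The complete graph on N vertices is a witness as soon as N >= 2. Its
    Laplacian is N I - J, with J the all-ones matrix, so its eigenvalues are 0,
    once, and N, with multiplicity N - 1: see [char_poly_laplacian_complete].
    Every vector whose entries sum to 0 is an eigenvector for N, in particular
    the difference of two basis vectors, which takes both signs.

    In a complete graph every nonempty set of vertices is connected. Hence, for
    a vector g without zero entry that takes both signs, the strong nodal
    domains are exactly {g > 0} and {g < 0}: see
    [card_strong_nodal_domains_complete]. Filling the zeros of an eigenvector
    with signs preserves the entries of both signs that it already has, so
    every filling has two strong nodal domains, and so does a best one. *)

Set Implicit Arguments.
Unset Strict Implicit.
Unset Printing Implicit Defensive.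

Import Order.TTheory GRing.Theory Num.Theory.
Local Open Scope ring_scope.

Definition complete_adj (n : nat) : rel 'I_n := fun u v => u != v.

Lemma complete_adj_sym n : symmetric (@complete_adj n).
Proof. by move=> u v; rewrite /complete_adj eq_sym. Qed.

Lemma complete_adj_irr n : irreflexive (@complete_adj n).
Proof. by move=> u; rewrite /complete_adj eqxx. Qed.

Definition complete_graph (n : nat) : sgraph n :=
  SGraph (@complete_adj_sym n) (@complete_adj_irr n).

Lemma connected_set_complete n (S : {set 'I_n}) :
  connected_set (complete_graph n) S = (S != set0).
Proof.
rewrite /connected_set; apply: andb_idr => _.
apply/forall_inP => x xS; apply/forall_inP => y yS.
have [->|neq_xy] := eqVneq x y; first exact: connect0.
by apply: connect1; rewrite /= xS yS.
Qed.

Section NodalDomains.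
Variables (n : nat) (R : realType).
Implicit Types f g : 'cV[R]_n.

Definition pos_support g : {set 'I_n} := [set v | 0 < g v 0].

Definition neg_support g : {set 'I_n} := [set v | g v 0 < 0].

Lemma one_signed_connected_complete g (S : {set 'I_n}) :
  one_signed_connected (complete_graph n) g S =
  (S != set0) && ((S \subset pos_support g) || (S \subset neg_support g)).
Proof.
rewrite /one_signed_connected connected_set_complete.
have [->|[v vS]] := set_0Vmem S; first by rewrite eqxx.
congr (_ && _); apply/forall_inP/orP => [sgS | [] /subsetP subS i iS].
- have gprod w : w \in S -> 0 < g v 0 * g w 0.
    by move=> wS; apply: (forall_inP (sgS v vS)).
  have [gv0|gv0|gv0] := ltrgt0P (g v 0).
  + left; apply/subsetP => w /gprod.
    by rewrite inE pmulr_rgt0.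
  + right; apply/subsetP => w /gprod.
    by rewrite inE nmulr_rgt0.
  + by have := gprod v vS; rewrite gv0 mul0r ltxx.
- apply/forall_inP => j jS.
  by move: (subS i iS) (subS j jS); rewrite !inE; apply: mulr_gt0.
- apply/forall_inP => j jS.
  by move: (subS i iS) (subS j jS); rewrite !inE => gi gj; rewrite nmulr_rgt0.
Qed.

Lemma neg_pos_supportF g v :
  v \in pos_support g -> v \in neg_support g -> False.
Proof. by rewrite !inE => /lt_trans gv /gv; rewrite ltxx. Qed.

(** The sets on which [g] has one sign are the nonempty subsets of [{g > 0}]
    and of [{g < 0}]; these two are nonempty and disjoint, so both are
    maximal. *)
Lemma strong_nodal_domains_complete g p q : 0 < g p 0 -> g q 0 < 0 ->
  strong_nodal_domains (complete_graph n) g =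
  [set pos_support g; neg_support g].
Proof.
move=> gp gq.
have pP : p \in pos_support g by rewrite inE.
have qN : q \in neg_support g by rewrite inE.
have P0 : pos_support g != set0 by apply/set0Pn; exists p.
have N0 : neg_support g != set0 by apply/set0Pn; exists q.
apply/setP => S; rewrite !inE; apply/maxsetP/orP; last first.
  case=> /eqP ->; split; rewrite ?one_signed_connected_complete ?subxx ?orbT ?andbT //.
  - move=> B; rewrite one_signed_connected_complete => /andP[_ /orP[] sB] sPB.
      by apply/eqP; rewrite eqEsubset sB sPB.
    case: (@neg_pos_supportF g p) => //.
    exact: (subsetP sB _ (subsetP sPB _ pP)).
  - move=> B; rewrite one_signed_connected_complete => /andP[_ /orP[] sB] sNB.
      case: (@neg_pos_supportF g q) => //.
      exact: (subsetP sB _ (subsetP sNB _ qN)).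
    by apply/eqP; rewrite eqEsubset sB sNB.
case; rewrite one_signed_connected_complete => /andP[_ /orP[] sS] maxS.
- by left; rewrite (maxS (pos_support g)) // one_signed_connected_complete P0 subxx.
- by right; rewrite (maxS (neg_support g)) // one_signed_connected_complete N0 subxx orbT.
Qed.

Lemma card_strong_nodal_domains_complete g p q : 0 < g p 0 -> g q 0 < 0 ->
  #|strong_nodal_domains (complete_graph n) g| = 2%N.
Proof.
move=> gp gq; rewrite (strong_nodal_domains_complete gp gq) cards2.
suff -> : pos_support g != neg_support g by [].
apply/eqP => PN; apply: (@neg_pos_supportF g p); last rewrite -PN.
all: by rewrite inE.
Qed.

Lemma nodal_decomposition_number_complete f p q : 0 < f p 0 -> f q 0 < 0 ->
  nodal_decomposition_number (complete_graph n) f = 2%N.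
Proof.
move=> fp fq; rewrite /nodal_decomposition_number.
case: ex_minnP => k /asboolP[g fill_g <-] _.
apply: (@card_strong_nodal_domains_complete g p q).
- by rewrite (fill_g p).1 // gt_eqF.
- by rewrite (fill_g q).1 // lt_eqF.
Qed.

End NodalDomains.

(** The matrix is brought to block triangular form by conjugation with the
    matrix [P] that replaces the first basis vector by the all-ones vector,
    an eigenvector for [a + b *+ m.+1]. *)
Lemma det_scalar_add_const (R : comNzRingType) (m : nat) (a b : R) :
  \det (a%:M + const_mx b : 'M[R]_m.+1) = (a + b *+ m.+1) * a ^+ m.
Proof.
pose c := a + b *+ m.+1.
pose P : 'M[R]_(1 + m) := block_mx 1%:M 0 (const_mx 1) 1%:M.
pose T : 'M[R]_(1 + m) := block_mx c%:M (const_mx b) 0 a%:M.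
have MP : (a%:M + const_mx b : 'M[R]_(1 + m)) *m P = P *m T.
  rewrite scalar_mx_block -block_mx_const add_block_mx !mulmx_block.
  rewrite !mul1mx !mulmx1 !mul0mx !mulmx0 !addr0 !add0r.
  have constM k l : (const_mx b : 'M[R]_(k, m)) *m (const_mx 1 : 'M[R]_(m, l))
                    = const_mx (b *+ m).
    apply/matrixP => i j; rewrite !mxE -[in RHS](card_ord m) -sumr_const.
    by apply: eq_bigr => s _; rewrite !mxE mulr1.
  have const1M : (const_mx 1 : 'M[R]_(m, 1)) *m (const_mx b : 'rV[R]_m)
                    = const_mx b.
    by apply/matrixP => i j; rewrite !mxE big_ord1 !mxE mul1r.
  rewrite mulmxDl !constM const1M mul_scalar_mx mul_mx_scalar.
  congr block_mx; last by rewrite addrC.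
    apply/matrixP => i j; rewrite !mxE !ord1 eqxx !mulr1n.
    by rewrite /c mulrS addrA.
  by apply/matrixP => i j; rewrite !mxE !mulr1 /c mulrS addrCA.
have /(congr1 determinant) := MP.
by rewrite !det_mulmx det_lblock det_ublock !det1 !det_scalar expr1 !mulr1 mul1r.
Qed.

Lemma laplacian_complete (R : realType) (n : nat) :
  laplacian (complete_graph n) R = n%:R%:M - const_mx 1.
Proof.
apply/matrixP => i j; rewrite !mxE /degree /= /complete_adj.
have -> : [set w | i != w] = [set~ i].
  by apply/setP => w; rewrite !inE eq_sym.
rewrite cardsC1 card_ord; case: n i j => [[]//|n] i j /=.
have [_|_] /= := eqVneq i j; last by rewrite !mulr0n.
by rewrite !mulr1n subr0 -[in RHS]natr1 addrK.
Qed.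

Lemma char_poly_laplacian_complete (R : realType) (m : nat) :
  char_poly (laplacian (complete_graph m.+1) R)
  = 'X * ('X - m.+1%:R%:P) ^+ m.
Proof.
rewrite laplacian_complete /char_poly.
have -> : char_poly_mx (m.+1%:R%:M - const_mx 1 : 'M[R]_m.+1)
          = ('X - m.+1%:R%:P)%:M + const_mx 1.
  by apply/matrixP => i j; rewrite !mxE !(polyCB, polyCMn, mulrnBl) opprB addrA addrAC.
rewrite det_scalar_add_const; congr (_ * _).
by rewrite polyCMn subrK.
Qed.

(** J annihilates a vector whose entries sum to 0. *)
Lemma laplacian_complete_sum0 (R : realType) (n : nat) (f : 'cV[R]_n) :
  \sum_i f i 0 = 0 -> laplacian (complete_graph n) R *m f = n%:R *: f.
Proof.
move=> sum_f; rewrite laplacian_complete mulmxBl mul_scalar_mx.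
suff -> : (const_mx 1 : 'M[R]_n) *m f = 0 by rewrite subr0.
apply/matrixP => i j; rewrite !mxE ord1 -[RHS]sum_f.
by apply: eq_bigr => k _; rewrite mxE mul1r.
Qed.

Theorem corollary2p11 (R : realType) :
  exists N0 : nat, forall N : nat, (N0 <= N)%N ->
  exists G : sgraph N, connected_graph G /\
  exists lam : N.-tuple R,
    [/\ ordered_eigenvalues (laplacian G R) lam,
        lam`_0 = 0,
        0 < lam`_1
      & forall i : nat, (1 < i < N)%N ->
        exists f : 'cV[R]_N,
          eigenvector (laplacian G R) lam`_i.-1 f /\
          nodal_decomposition_number G f = 2%N].
Proof.
exists 2%N => -[|[|m]] // _; set N := m.+2.
exists (complete_graph N); split.
  by rewrite /connected_graph connected_set_complete; apply/set0Pn; exists ord0.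
exists [tuple of 0 :: nseq m.+1 N%:R]; split=> //=.
- split=> /=.
    have path_nseq (x : R) k : path <=%R x (nseq k x).
      by elim: k => //= k ->; rewrite lexx.
    by rewrite !ler0n path_nseq.
  rewrite char_poly_laplacian_complete (big_cons _ _ _ (nseq m.+1 _)) subr0.
  by rewrite (big_nseq _ _ m.+1) iter_mulr_1.
move=> [|[|i]] //= iN.
pose f : 'cV[R]_N := delta_mx ord0 0 - delta_mx ord_max 0.
have f0 : f ord0 0 = 1 by rewrite !mxE /= subr0.
have fmax : f ord_max 0 = -1 by rewrite !mxE /= sub0r !eqxx.
exists f; split; last first.
  apply: (@nodal_decomposition_number_complete _ _ f ord0 ord_max).
  - by rewrite f0.
  - by rewrite fmax oppr_lt0.
split.
  by apply/eqP => /matrixP/(_ ord0 0); rewrite f0 mxE; apply/eqP/oner_neq0.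
have -> : (N%:R :: nseq m N%:R)`_i = N%:R :> R.
  by rewrite (nth_nseq 0 m.+1) ltnW.
apply: laplacian_complete_sum0.
rewrite (eq_bigr (fun k => (k == ord0)%:R - (k == ord_max)%:R)); last first.
  by move=> k _; rewrite !mxE !andbT.
have sum_delta (p : 'I_N) : \sum_k (k == p)%:R = 1 :> R.
  by rewrite (bigD1 p) //= eqxx big1 ?addr0 // => k /negPf ->.
by rewrite sumrB !sum_delta subrr.
Qed.
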